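(* There exist a three-dimensional cyclic matching instance $\mathcal I$ (with possibly incomplete preference lists) and a matching $M$ in $\mathcal I$ such that $M$ is strongly popular but not weakly stable.
   Context: A three-dimensional cyclic matching instance with (possibly) incomplete lists consists of three pairwise disjoint finite sets (agent classes) $A,B,C$ with $|A|=|B|=|C|=n$. Each agent in $A$ (resp. $B$, resp. $C$) has a strict preference list over a subset of the agents in $B$ (resp. $C$, resp. $A$); the agents on the list of $x$ are called acceptable to $x$, and $\succ_x$ denotes the strict order, $y\succ_x z$ meaning that $x$ prefers $y$ to $z$. By convention $x$ itself is placed at the end of $\succ_x$ (being unmatched is worst). Let $V=A\cup B\cup C$. A matching $M$ is a subset of $A\times B\times C$ such that each agent appears in at most one triple and for each $(a,b,c)\in M$, $a$ finds $b$ acceptable, $b$ finds $c$ acceptable, and $c$ finds $a$ acceptable. If $(a,b,c)\in M$, write $M(a)=b$, $M(b)=c$, $M(c)=a$; if $x$ is in no triple of $M$, then $M(x)=x$. Agents compare triples containing them by their partner in the triple ($a$ by $b$, $b$ by $c$, $c$ by $a$). A triple $t=(a,b,c)$ (with $a$ finding $b$, $b$ finding $c$, and $c$ finding $a$ acceptable) is a strongly blocking triple for $M$ if each of $a,b,c$ prefers $t$ to her situation in $M$. $M$ is weakly stable if it admits no strongly blocking triple. For matchings $M',M$ and an agent $x$, let $\mathrm{vote}_x(M',M)=1$ if $M'(x)\succ_x M(x)$, $0$ if $M'(x)=M(x)$, and $-1$ if $M(x)\succ_x M'(x)$. $M'$ is more popular than $M$ if $\sum_{x\in V}\mathrm{vote}_x(M',M)\ge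 1$. $M$ is strongly popular if $M$ is more popular than every other matching $M'\neq M$. *)

(* Defs.v *)
From HB Require Import structures.
From mathcomp Require Import all_boot all_order all_algebra.

Set Implicit Arguments.
Unset Strict Implicit.
Unset Printing Implicit Defensive.

Import Order.TTheory GRing.Theory Num.Theory.
Local Open Scope ring_scope.

(* Each preference list enumerates exactly the acceptable agents, the most
   preferred one first. *)
Record instance := Instance {
  class_size : nat;
  agentA : finType;
  agentB : finType;
  agentC : finType;
  card_agentA : #|agentA| = class_size;
  card_agentB : #|agentB| = class_size;
  card_agentC : #|agentC| = class_size;
  prefA : agentA -> seq agentB;
  prefB : agentB -> seq agentC;
  prefC : agentC -> seq agentA;
  prefA_uniq : forall a, uniq (prefA a);
  prefB_uniq : forall b, uniq (prefB b);
  prefC_uniq : forall c, uniq (prefC c)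
}.

(* The classes are disjoint because this is a sum type. *)
Definition agent (I : instance) : finType :=
  (agentA I + agentB I + agentC I)%type.

Definition ofA (I : instance) (a : agentA I) : agent I := inl (inl a).
Definition ofB (I : instance) (b : agentB I) : agent I := inl (inr b).
Definition ofC (I : instance) (c : agentC I) : agent I := inr c.

Definition triple (I : instance) : finType :=
  (agentA I * agentB I * agentC I)%type.

(* The list of x, followed by x itself: being unmatched is the worst outcome. *)
Definition pref (I : instance) (x : agent I) : seq (agent I) :=
  rcons
    match x with
    | inl (inl a) => map (@ofB I) (prefA a)
    | inl (inr b) => map (@ofC I) (prefB b)
    | inr c => map (@ofA I) (prefC c)
    end x.

Definition prefers (I : instance) (x y z : agent I) : bool :=
  [&& y \in pref x, z \in pref x & (index y (pref x) < index z (pref x))%N].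

Definition acceptable (I : instance) (t : triple I) : bool :=
  let: (a, b, c) := t in [&& b \in prefA a, c \in prefB b & a \in prefC c].

Definition members (I : instance) (t : triple I) : seq (agent I) :=
  let: (a, b, c) := t in [:: ofA a; ofB b; ofC c].

(* [next] reads the triple as a cycle: a |-> b, b |-> c, c |-> a. *)
Definition partner_in (I : instance) (t : triple I) (x : agent I) : agent I :=
  next (members t) x.

Definition matching (I : instance) (M : {set triple I}) : Prop :=
  (forall t, t \in M -> acceptable t) /\
  (forall x : agent I, (#|[set t in M | x \in members t]| <= 1)%N).

(* M(x); the picked triple is unique when M is a matching. *)
Definition partner (I : instance) (M : {set triple I}) (x : agent I) :
    agent I :=
  if [pick t in M | x \in members t] is Some t then partner_in t x else x.

Definition strongly_blocking (I : instance) (M : {set triple I})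
    (t : triple I) : Prop :=
  acceptable t /\
  (forall x, x \in members t -> prefers x (partner_in t x) (partner M x)).

Definition weakly_stable (I : instance) (M : {set triple I}) : Prop :=
  ~ exists t : triple I, strongly_blocking M t.

(* For matchings the last case is equality: both partners occur in [pref x]. *)
Definition vote (I : instance) (M' M : {set triple I}) (x : agent I) : int :=
  if prefers x (partner M' x) (partner M x) then 1
  else if prefers x (partner M x) (partner M' x) then -1
  else 0.

Definition more_popular (I : instance) (M' M : {set triple I}) : Prop :=
  1 <= \sum_(x : agent I) vote M' M x.

Definition strongly_popular (I : instance) (M : {set triple I}) : Prop :=
  forall M' : {set triple I}, matching M' -> M' <> M -> more_popular M M'.

(* Main.v *)
(** Let M be the three triples (a_i, b_i, c_i) and let t = (a_0, b_1, c_2) be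
    the only other acceptable triple, which its three members rank first.
    Then t blocks M, but t meets every triple of M, so a matching containing t
    is {t}: it leaves six agents unmatched and loses to M by 6 votes to 3.
    Every other matching is a subset of M. *)
Require Import Defs.
From mathcomp Require Import all_boot all_order all_algebra.

Set Implicit Arguments.
Unset Strict Implicit.
Unset Printing Implicit Defensive.

(** A form of [partner] that [vm_compute] can evaluate once the triples are listed explicitly. *)
Definition seq_partner (I : instance) (s : seq (triple I)) (x : agent I) :
    agent I :=
  if [seq t <- s | x \in members t] is t :: _ then partner_in t x else x.

(** In a matching at most one triple contains [x], so the arbitrary choice made by [pick] and the
    head of the filtered list coincide. *)
Lemma partner_seq (I : instance) (M : {set triple I}) (s : seq (triple I)) :
  matching M -> M =i s -> partner M =1 seq_partner s.
Proof.
case=> _ M1 eqMs x; rewrite /partner /seq_partner.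
have inE1 t : (t \in [seq t <- s | x \in members t])
    = (t \in M) && (x \in members t) by rewrite mem_filter andbC eqMs.
case: pickP => [t tMx | noM]; last first.
  by case: filter inE1 => // t l /(_ t); rewrite mem_head noM.
case: filter inE1 => [/(_ t) | t' l /(_ t')]; first by rewrite tMx.
rewrite mem_head => /esym t'Mx.
by have /card_le1_eqP/(_ t t') -> := M1 x; rewrite ?inE.
Qed.

Definition i0 : 'I_3 := @Ordinal 3 0 isT.
Definition i1 : 'I_3 := @Ordinal 3 1 isT.
Definition i2 : 'I_3 := @Ordinal 3 2 isT.

(** Here [i] is the index of the class's member in [blocker] and [j] that of her partner there. *)
Definition ex_pref (i j k : 'I_3) : seq 'I_3 :=
  if k == i then [:: j; i] else [:: k].

Lemma ex_pref_uniq (i j : 'I_3) : j != i -> forall k, uniq (ex_pref i j k).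
Proof. by move=> ji k; rewrite /ex_pref; case: ifP => //=; rewrite inE ji. Qed.

Definition ex_inst : instance :=
  @Instance 3 'I_3 'I_3 'I_3 (card_ord 3) (card_ord 3) (card_ord 3)
    (ex_pref i0 i1) (ex_pref i1 i2) (ex_pref i2 i0)
    (ex_pref_uniq (isT : i1 != i0)) (ex_pref_uniq (isT : i2 != i1))
    (ex_pref_uniq (isT : i0 != i2)).

Definition diag (i : 'I_3) : triple ex_inst := (i, i, i).

Definition blocker : triple ex_inst := (i0, i1, i2).

Definition ex_matching : {set triple ex_inst} :=
  [set t in [:: diag i0; diag i1; diag i2]].

Lemma acceptable_ex (t : triple ex_inst) :
  acceptable t = (t \in [:: blocker; diag i0; diag i1; diag i2]).
Proof.
by case: t => [[[[|[|[|?]]] ?] [[|[|[|?]]] ?]] [[|[|[|?]]] ?]].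
Qed.

Lemma ex_matchingP : matching ex_matching.
Proof.
split=> [t | x].
  by rewrite in_set acceptable_ex => tM; rewrite in_cons tM orbT.
apply/card_le1_eqP => t1 t2; rewrite !in_set !inE.
(* Only pairs of distinct diagonal triples survive [//], and these share no agent. *)
move=> /andP[/or3P[]/eqP-> x1] /andP[/or3P[]/eqP-> x2] //; exfalso;
by case: x x1 x2 => [[]|] [[|[|[|?]]] ?].
Qed.

Lemma partner_ex : partner ex_matching =1
  seq_partner [:: diag i0; diag i1; diag i2].
Proof. by apply: (partner_seq ex_matchingP) => t; rewrite in_set. Qed.

Lemma ex_not_weakly_stable : ~ weakly_stable ex_matching.
Proof.
apply; exists blocker; split=> [|x]; first by rewrite acceptable_ex.
by rewrite !inE partner_ex => /or3P[]/eqP->; vm_compute.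
Qed.

Lemma blocker_disjoint (M : {set triple ex_inst}) (i : 'I_3) :
  matching M -> blocker \in M -> diag i \notin M.
Proof.
case=> _ M1 bM; apply/negP => dM.
have [x xb xd] : exists2 x, x \in members blocker & x \in members (diag i).
  by case: i {dM} => [[|[|[|?]]] ?] //;
    [exists (ofA (i0 : agentA ex_inst)) | exists (ofB (i1 : agentB ex_inst))
    | exists (ofC (i2 : agentC ex_inst))].
have /card_le1_eqP/(_ blocker (diag i)) := M1 x.
rewrite !in_set bM xb dM xd => /(_ isT isT) e.
(* Equality with [blocker] would force [i] to be both its first and its last index. *)
have e0 : i = i0 := congr1 (fun t : triple ex_inst => t.1.1) e.
by have : i = i2 := congr1 snd e; rewrite e0.
Qed.

Lemma ex_strongly_popular : strongly_popular ex_matching.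
Proof.
move=> M' M'P neq.
(* Listing [M'] this way makes every vote depend on four booleans only, the memberships of the
   acceptable triples. *)
pose s := [seq t <- [:: blocker; diag i0; diag i1; diag i2] | t \in M'].
have eqs : M' =i s.
  move=> t; rewrite mem_filter -acceptable_ex; case tM: (t \in M') => //=.
  by rewrite (M'P.1 t tM).
have neqs : ~ s =i [:: diag i0; diag i1; diag i2].
  by move=> e; apply: neq; apply/setP => t; rewrite eqs e in_set.
have dis i := @blocker_disjoint M' i M'P.
rewrite /more_popular.
under eq_bigr => x _ do rewrite /vote partner_ex (partner_seq M'P eqs).
rewrite !big_sumType /= !big_ord_recl !big_ord0.
move: neqs; rewrite /s /=.
(* If [blocker] is in [M'], disjointness reduces [s] to that single triple. *)
case: ifP dis => [_ /(_ _ isT) dis _ | _ _].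
  by rewrite !(negPf (dis _)); vm_compute.
(* Among the eight subsets of the diagonal, [neqs] excludes the full one; in the others each missing
   triple gives [ex_matching] three votes and all other agents tie. *)
case: (diag i0 \in M'); case: (diag i1 \in M'); case: (diag i2 \in M');
  by [move=> /(_ (fun=> erefl)) | move=> _; vm_compute].
Qed.

Theorem lemma2 :
  exists (I : instance) (M : {set triple I}),
    [/\ matching M, strongly_popular M & ~ weakly_stable M].
Proof.
exists ex_inst, ex_matching; split.
- exact: ex_matchingP.
- exact: ex_strongly_popular.
- exact: ex_not_weakly_stable.
Qed.
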